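(* Let $U \times V \in \mathrm{op}(X_{sa} \times S)$, with $U\in \mathrm{op}(X_{sa})$ and $V\in\mathrm{op}(S)$, and let $F \in \mathrm{Mod}(\mathbb{C}_{X_{sa} \times S_{sa}})$. Then $$\Gamma(U \times V;a^{-1}F) \simeq \varprojlim_{V' \subset\subset V}\Gamma(U \times V';F),$$ where $V'$ ranges over the subanalytic open subsets of $S$ which are relatively compact in $V$.
   Context: $X$ and $S$ are real analytic manifolds. $\mathrm{op}(S)$ is the category of open subsets of $S$ and $\mathrm{op}(X_{sa})$ is the category of open subanalytic subsets of $X$. The subanalytic site $X_{sa}$: a family $\Sigma \subset \mathrm{op}(X_{sa})$ is a covering of $U \in \mathrm{op}(X_{sa})$ if for every compact $K\subset X$ there is a finite $\Sigma_0\subset \Sigma$ with $K\cap\bigcup_{V\in \Sigma_0}V=K\cap U$. The site $X_{sa}\times S_{sa}$: let $\mathcal{T}$ be the family of products $U\times V$ with $U\in \mathrm{op}(X_{sa})$, $V\in \mathrm{op}(S_{sa})$ relatively compact. Open sets of the site are locally finite unions of elements of $\mathcal{T}$; a family is a covering of $U\times V\in\mathcal{T}$ if it admits a finite subcover, and a family $T$ is a covering of a general $W$ if for every $U\times V\in \mathcal{T}$ contained in $W$ the family $\{W'\cap (U\times V): W'\in T\}$ is a covering of $U\times V$. The site $X_{sa}\times S$: open sets are finite unions of products $U\times V$ with $U\in \mathrm{op}(X_{sa})$, $V\in \mathrm{op}(S)$. A family is a covering of $U\times V$ iff it admits a refinement $\{U_i\times V_j\}_{i\in I,j\in J}$ with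 $\{U_i\}_{i\in I}$ a covering of $U$ in $X_{sa}$ and $\{V_j\}_{j\in J}$ an open covering of $V$; a family $T$ covers a general $W$ if for each product $U\times V\subset W$ the restriction of $T$ to $U\times V$ is a covering of $U\times V$. $a: X_{sa}\times S\to X_{sa}\times S_{sa}$ is the natural morphism of sites induced by the inclusion of families of open subsets, and $a^{-1}$ is the inverse image functor on sheaves. $\mathrm{Mod}(\mathbb{C}_{\mathcal{X}})$ denotes the category of sheaves of $\mathbb{C}$-vector spaces on a site $\mathcal{X}$. *)

(* Defs.v *)
From HB Require Import structures.
From mathcomp Require Import all_boot all_order all_algebra.
From mathcomp Require Import all_classical all_reals all_analysis.
From mathcomp Require Export complex.
Import Order.TTheory GRing.Theory Num.Theory.
Import numFieldNormedType.Exports.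

Set Implicit Arguments.
Unset Strict Implicit.
Unset Printing Implicit Defensive.

Local Open Scope classical_set_scope.
Local Open Scope ring_scope.

Section Analytic.
Context {R : realType}.

Definition monomial n (h : 'rV[R]_n) (a : {ffun 'I_n -> nat}) : R :=
  \prod_(i < n) h 0 i ^+ a i.

(* The sum runs over the finite box of multi-indices with all entries < N. *)
Definition box_sum n (u : {ffun 'I_n -> nat} -> R) (N : nat) : R :=
  \sum_(a : {ffun 'I_n -> 'I_N}) u [ffun i => nat_of_ord (a i)].

(* f is the sum of an absolutely convergent power series near x. *)
Definition analytic_at n (f : 'rV[R]_n -> R) (x : 'rV[R]_n) : Prop :=
  exists (c : {ffun 'I_n -> nat} -> R) (r : R), 0 < r /\
    forall h : 'rV[R]_n, (forall i, `|h 0 i| < r) ->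
      cvgn (box_sum (fun a => `|c a * monomial h a|)) /\
      box_sum (fun a => c a * monomial h a) @ \oo --> f (x + h).

(* Near p, the set E is a finite union of finite intersections of sets
   {f = 0} and {g > 0} with f, g analytic.  A single rectangular index set
   suffices: shorter lists of conditions are padded with f = 0 or g = 1. *)
Definition semianalytic_at n (E : set 'rV[R]_n) (p : 'rV[R]_n) : Prop :=
  exists (N : set 'rV[R]_n) (m k : nat) (f g : 'I_m -> 'I_k -> 'rV[R]_n -> R),
    [/\ nbhs p N,
        forall i j y, N y -> analytic_at (f i j) y /\ analytic_at (g i j) y &
        N `&` E =
        N `&` [set y | exists i, forall j, f i j y = 0 /\ 0 < g i j y]].

Record chart (M : topologicalType) (n : nat) := Chart {
  chart_dom : set M;
  chart_fun :> M -> 'rV[R]_n;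
  chart_inv : 'rV[R]_n -> M;
  chart_dom_open : open chart_dom;
  chart_img_open : open (chart_fun @` chart_dom);
  chart_continuous : {within chart_dom, continuous chart_fun};
  chart_inv_continuous :
    {within chart_fun @` chart_dom, continuous chart_inv};
  chart_funK : forall x, chart_dom x -> chart_inv (chart_fun x) = x }.

Record analytic_manifold := AnalyticManifold {
  manifold_space :> topologicalType;
  manifold_dim : nat;
  atlas : set (chart manifold_space manifold_dim);
  manifold_hausdorff : hausdorff_space manifold_space;
  manifold_second_countable : @second_countable manifold_space;
  atlas_cover : forall x : manifold_space,
    exists2 phi, atlas phi & chart_dom phi x;
  atlas_analytic : forall phi psi, atlas phi -> atlas psi ->
    forall x, chart_dom phi x -> chart_dom psi x ->
    forall i, analytic_at (fun y => phi (chart_inv psi y) 0 i) (psi x) }.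

Definition rel_compact (T : topologicalType) (A : set T) : Prop :=
  compact (closure A).

Definition rel_compact_in (T : topologicalType) (A B : set T) : Prop :=
  compact (closure A) /\ closure A `<=` B.

(* Semianalytic subsets of M x R^k, tested at every point (not only at the
   points of B) and read in the charts (phi, id) into R^(dim M + k).  Analytic
   transition maps make the choice of the chart at x immaterial. *)
Definition semianalytic (M : analytic_manifold) (k : nat)
    (B : set (M * 'rV[R]_k)) : Prop :=
  forall (x : M) (y : 'rV[R]_k) (phi : chart M (manifold_dim M)),
    atlas phi -> chart_dom phi x ->
    semianalytic_at
      [set row_mx (phi z.1) z.2 | z in B `&` (chart_dom phi `*` setT)]
      (row_mx (phi x) y).

(* Locally the projection of a relatively compact semianalytic set. *)
Definition subanalytic (M : analytic_manifold) (A : set M) : Prop :=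
  forall x : M, exists (N : set M) (k : nat) (B : set (M * 'rV[R]_k)),
    [/\ open_nbhs x N, rel_compact B, semianalytic B
      & A `&` N = [set z.1 | z in B]].

Definition op_sa (M : analytic_manifold) (U : set M) : Prop :=
  open U /\ subanalytic U.

Definition cover_sa (M : analytic_manifold) (U : set M)
    (Sigma : set (set M)) : Prop :=
  [/\ Sigma `<=` @op_sa M,
      forall A, Sigma A -> A `<=` U
    & forall K : set M, compact K -> exists Sigma0 : set (set M),
        [/\ finite_set Sigma0, Sigma0 `<=` Sigma
          & K `&` \bigcup_(A in Sigma0) A = K `&` U]].

End Analytic.
Arguments analytic_manifold R : clear implicits.

Definition locally_finite (T : topologicalType) (L : set (set T)) : Prop :=
  forall x : T, exists2 N, nbhs x N & finite_set [set A | L A /\ A `&` N !=set0].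

(* Only the data of a site whose objects are subsets of a fixed set, ordered by
   inclusion; a covering of W consists of objects contained in W. *)
Record site (E : Type) := Site {
  site_op : set (set E);
  site_cov : set E -> set (set E) -> Prop }.

Definition opens (E : Type) (Y : site E) := {W : set E | site_op Y W}.

Definition opens_set E (Y : site E) (W : opens Y) : set E := proj1_sig W.
Coercion opens_set : opens >-> set.

Section Sites.
Context {R : realType} (X S : analytic_manifold R).

(* The family T of the site X_sa x S_sa. *)
Definition sasa_box : set (set (X * S)) :=
  [set P | exists (U : set X) (V : set S),
     [/\ op_sa U /\ rel_compact U, op_sa V /\ rel_compact V & P = U `*` V]].

Definition sasa_op (W : set (X * S)) : Prop :=
  exists L : set (set (X * S)),
    [/\ L `<=` sasa_box, locally_finite L & W = \bigcup_(P in L) P].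

(* The site X_sa x S_sa. *)
Definition site_sasa : site (X * S) := {|
  site_op := sasa_op;
  site_cov := fun W T =>
    [/\ T `<=` sasa_op,
        forall W', T W' -> W' `<=` W
      & forall P, sasa_box P -> P `<=` W ->
          exists T0 : set (set (X * S)),
            [/\ finite_set T0, T0 `<=` [set W' `&` P | W' in T]
              & \bigcup_(Q in T0) Q = P]] |}.

Definition rel_op (W : set (X * S)) : Prop :=
  exists L : set (set (X * S)),
    [/\ finite_set L,
        L `<=` [set P | exists (U : set X) (V : set S),
                  [/\ op_sa U, open V & P = U `*` V]]
      & W = \bigcup_(P in L) P].

Definition rel_cov_prod (U : set X) (V : set S) (T : set (set (X * S))) : Prop :=
  exists (Sigma : set (set X)) (C : set (set S)),
    [/\ cover_sa U Sigma,
        C `<=` open /\ \bigcup_(B in C) B = V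
      & forall A B, Sigma A -> C B -> exists2 W', T W' & A `*` B `<=` W'].

(* The site X_sa x S. *)
Definition site_rel : site (X * S) := {|
  site_op := rel_op;
  site_cov := fun W T =>
    [/\ T `<=` rel_op,
        forall W', T W' -> W' `<=` W
      & forall (U : set X) (V : set S), op_sa U -> open V -> U `*` V `<=` W ->
          rel_cov_prod U V [set W' `&` (U `*` V) | W' in T]] |}.

Lemma rel_op_prod (U : set X) (V : set S) :
  op_sa U -> open V -> rel_op (U `*` V).
Proof.
move=> hU hV; exists [set U `*` V]; split; first exact: finite_set1.
  by move=> _ ->; exists U, V.
by rewrite bigcup_set1.
Qed.

Definition rel_prod (U : set X) (V : set S) (hU : op_sa U) (hV : open V) :
  opens site_rel := exist _ (U `*` V) (rel_op_prod hU hV).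

(* The opens U x V' of X_sa x S_sa, with V' relatively compact in V; they index
   the projective limit.  Although U need not be relatively compact, U x V' is
   always an open of X_sa x S_sa: intersect U with a locally finite covering of X
   by relatively compact open subanalytic sets. *)
Definition slices (U : set X) (V : set S) : set (opens site_sasa) :=
  [set W | exists V' : set S,
     [/\ op_sa V', rel_compact_in V' V & (W : set (X * S)) = U `*` V']].

End Sites.

Section Sheaves.
Context {K : comNzRingType} {E : Type}.

Record presheaf (Y : site E) := Presheaf {
  sections :> opens Y -> lmodType K;
  res : forall W' W : opens Y, W' `<=` W -> {linear sections W -> sections W'};
  res_id : forall (W : opens Y) (h : W `<=` W) s, res h s = s;
  res_comp : forall (W'' W' W : opens Y) (h'' : W'' `<=` W') (h' : W' `<=` W)
    (h : W'' `<=` W) s, res h'' (res h' s) = res h s }.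

(* Agreement on W1 `&` W2 is tested on all the opens contained in it.  Only the
   values of the family s on the members of T matter. *)
Definition is_sheaf (Y : site E) (F : presheaf Y) : Prop :=
  forall (W : opens Y) (T : set (set E)), site_cov Y W T ->
  forall s : (forall W' : opens Y, F W'),
    (forall W1 W2 W' : opens Y, T W1 -> T W2 ->
       forall (h1 : W' `<=` W1) (h2 : W' `<=` W2),
       res F h1 (s W1) = res F h2 (s W2)) ->
    exists! t : F W, forall (W' : opens Y) (h : W' `<=` W), T W' ->
      res F h t = s W'.

Record presheaf_hom (Y : site E) (F G : presheaf Y) := PresheafHom {
  hom_sec :> forall W : opens Y, {linear F W -> G W};
  hom_nat : forall (W' W : opens Y) (h : W' `<=` W) s,
    res G h (hom_sec W s) = hom_sec W' (res F h s) }.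

(* For a : Z -> Y given by comparing subsets of E: a compatible family of maps
   F W' -> G W for W contained in W', that is, a morphism of presheaves on Z
   from (W |-> colim_(W' containing W) F W') to G. *)
Record cross_hom (Y Z : site E) (F : presheaf Y) (G : presheaf Z) := CrossHom {
  cross_sec :> forall (W : opens Z) (W' : opens Y), W `<=` W' ->
    {linear F W' -> G W};
  cross_natl : forall (W1 W2 : opens Z) (W' : opens Y) (h : W1 `<=` W2)
    (h1 : W1 `<=` W') (h2 : W2 `<=` W') s,
    res G h (cross_sec h2 s) = cross_sec h1 s;
  cross_natr : forall (W : opens Z) (W1 W2 : opens Y) (h : W1 `<=` W2)
    (h1 : W `<=` W1) (h2 : W `<=` W2) s,
    cross_sec h1 (res F h s) = cross_sec h2 s }.

(* (G, eta) is the inverse image of F: the sheaf associated to the presheaf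
   W |-> colim_(W' containing W) F W', characterized, as a^{-1} in the adjunction
   with the direct image, by its universal property among sheaves on Z. *)
Definition is_inverse_image (Y Z : site E) (F : presheaf Y) (G : presheaf Z)
    (eta : cross_hom F G) : Prop :=
  is_sheaf G /\
  forall (H : presheaf Z) (theta : cross_hom F H), is_sheaf H ->
    (exists psi : presheaf_hom G H,
       forall (W : opens Z) (W' : opens Y) (h : W `<=` W') s,
         psi W (eta W W' h s) = theta W W' h s) /\
    (forall psi1 psi2 : presheaf_hom G H,
       (forall (W : opens Z) (W' : opens Y) (h : W `<=` W') s,
          psi1 W (eta W W' h s) = psi2 W (eta W W' h s)) ->
       forall (W : opens Z) s, psi1 W s = psi2 W s).

(* The maps p exhibit L as the projective limit of the F W, W in I. *)
Definition is_proj_lim (Y : site E) (F : presheaf Y) (I : set (opens Y))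
    (L : lmodType K) (p : forall W, I W -> {linear L -> F W}) : Prop :=
  (forall (W1 W2 : opens Y) (i1 : I W1) (i2 : I W2) (h : W1 `<=` W2) x,
     res F h (p W2 i2 x) = p W1 i1 x) /\
  forall s : (forall W, I W -> F W),
    (forall (W1 W2 : opens Y) (i1 : I W1) (i2 : I W2) (h : W1 `<=` W2),
       res F h (s W2 i2) = s W1 i1) ->
    exists! x : L, forall W i, p W i x = s W i.

End Sheaves.
Arguments presheaf K {E} Y.

(* Main.v *)
(** For an open W of X_sa x S, let G(W) be the projective limit of F over the
    boxes A x B of X_sa x S_sa with A x cl(B) contained in W.  The compactness of
    cl(A) and cl(B) turns a covering of W into finite coverings of these boxes,
    so G is a sheaf on X_sa x S.  Restriction gives a compatible family of maps
    F -> G, hence a morphism a^{-1}F -> G.  Conversely W is covered by the same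
    boxes, which are opens of both sites, so a section of G over W glues to a
    section of a^{-1}F.  These morphisms are inverse to each other, and over
    W = U x V the boxes are cofinal with the opens U x V' of the limit, because
    a section of F over U x V' is a compatible family over the boxes inside it.

    The analytic geometry enters through coordinate cubes: they are a base of
    relatively compact open subanalytic sets, stable under intersection with any
    open subanalytic set, and X has a locally finite covering by them. *)

From HB Require Import structures.
Require Import Defs.
From mathcomp Require Import all_boot all_order all_algebra finmap.
From mathcomp Require Import all_classical all_reals all_analysis lra.
Import Order.TTheory GRing.Theory Num.Theory.
Import numFieldNormedType.Exports.
Local Open Scope classical_set_scope.
Local Open Scope ring_scope.
Set Implicit Arguments.
Unset Strict Implicit.
Unset Printing Implicit Defensive.

(** * Compactness and finite subcovers *)

Lemma compact_subcover (T : topologicalType) (K : set T) (P : set (set T)) :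
  compact K -> (forall x, K x -> exists A, [/\ P A, open A & A x]) ->
  exists P0, [/\ finite_set P0, P0 `<=` P & K `<=` \bigcup_(A in P0) A].
Proof.
move=> cK KP; have [[x0 _]|K0] := pselect (K !=set0); last first.
  by exists set0; split=> // x Kx; case: K0; exists x.
(* A point of [K] makes the space pointed, as [compact_cover] requires. *)
pose pT : ptopologicalType := HB.pack T (isPointed.Build T x0).
have : cover_compact (K : set pT) by rewrite -compact_cover.
move=> /(_ (set T : choiceType) [set A | P A /\ open A] id) [A []//|x Kx|D DP KD].
  by have [A [PA oA Ax]] := KP x Kx; exists A.
exists [set` D]; split=> //; first exact: finite_fset.
by move=> A /= /DP; rewrite inE => -[].
Qed.

Lemma rel_compactS (T : topologicalType) (A B : set T) :
  A `<=` B -> rel_compact B -> rel_compact A.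
Proof.
move=> AB cB; apply: subclosed_compact cB _; first exact: closed_closure.
exact: closureS.
Qed.

Lemma rel_compact_set0 (T : topologicalType) : rel_compact (set0 : set T).
Proof. by rewrite /rel_compact closure0; exact: compact0. Qed.

(** * Analytic functions and semianalytic sets *)

Section Analytic.
Context {R : realType}.

(** Box sums of size 0 may be empty, so two series are compared only from size 1 on; limits do not
    see the difference. *)
Lemma cvg_shift_eq (u v : R^nat) (k l : R) :
  (forall N, u N.+1 = v N.+1 + k) -> v @ \oo --> l -> u @ \oo --> l + k.
Proof.
move=> uv vl; rewrite -cvg_shiftS.
have -> : (fun N => u N.+1) = (fun N => v N.+1 + k) by apply/funext => N; exact: uv.
by apply: cvgD; [rewrite cvg_shiftS|exact: cvg_cst].
Qed.

(** The zero multi-index occurs exactly once in every box of positive size, so a change of the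
    constant coefficient shifts the sum by the same amount. *)
Lemma box_sumD0 n (u : {ffun 'I_n -> nat} -> R) (k : R) (N : nat) :
  box_sum (fun a => u a + (a == [ffun=> 0%N])%:R * k) N.+1 = box_sum u N.+1 + k.
Proof.
rewrite /box_sum big_split /=; congr (_ + _).
rewrite (bigD1 [ffun=> ord0]) //= big1 => [|a a0].
  rewrite addr0 (_ : _ == _ = true) ?mul1r //.
  by apply/eqP/ffunP => i; rewrite !ffunE.
rewrite (_ : _ == _ = false) ?mul0r //; apply/negbTE; apply: contra a0 => /eqP a0.
by apply/eqP/ffunP => i; apply: val_inj; have /ffunP/(_ i) := a0; rewrite !ffunE.
Qed.

Lemma monomial0 n (h : 'rV[R]_n) : monomial h [ffun=> 0%N] = 1.
Proof. by rewrite /monomial big1 // => i _; rewrite ffunE expr0. Qed.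

Lemma analytic_at_addc n (f : 'rV[R]_n -> R) x (k : R) :
  analytic_at f x -> analytic_at (fun y => f y + k) x.
Proof.
move=> [c [r [r0 cf]]]; pose c' a := c a + (a == [ffun=> 0%N])%:R * k.
exists c', r; split=> // h /cf[cvg_abs cvg_f].
have c'E : (fun a => c' a * monomial h a)
    = (fun a => c a * monomial h a + (a == [ffun=> 0%N])%:R * k).
  apply/funext => a; rewrite /c' mulrDl; case: eqVneq => [->|_].
    by rewrite monomial0 !mulr1.
  by rewrite !mul0r.
(* Among the absolute values only the constant term changes, by the difference displayed here. *)
have c'abs : (fun a => `|c' a * monomial h a|)
    = (fun a => `|c a * monomial h a| + (a == [ffun=> 0%N])%:R
        * (`|c [ffun=> 0%N] + k| - `|c [ffun=> 0%N]|)).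
  apply/funext => a; rewrite /c'; case: eqVneq => [->|_].
    by rewrite monomial0 !mulr1 !mul1r subrKC.
  by rewrite !mul0r !addr0.
split.
  move: cvg_abs => /cvg_ex[l cvg_abs]; apply/cvg_ex.
  by exists (l + (`|c [ffun=> 0%N] + k| - `|c [ffun=> 0%N]|));
    apply: cvg_shift_eq cvg_abs => N; rewrite c'abs box_sumD0.
by apply: cvg_shift_eq cvg_f => N; rewrite c'E box_sumD0.
Qed.

Lemma analytic_at_cst n (k : R) (x : 'rV[R]_n) : analytic_at (fun=> k) x.
Proof.
have -> : (fun=> k) = (fun y : 'rV[R]_n => 0 + k) by apply/funext => y; rewrite add0r.
apply: analytic_at_addc; exists (fun=> 0), 1; split=> // h _.
have -> : box_sum (fun a => `|0 * monomial h a|) = (fun=> 0).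
  by apply/funext => N; apply: big1 => a _; rewrite mul0r normr0.
have -> : box_sum (fun a => 0 * monomial h a) = (fun=> 0).
  by apply/funext => N; apply: big1 => a _; rewrite mul0r.
by split; [exact: is_cvg_cst|exact: cvg_cst].
Qed.

Lemma analytic_at_opp n (f : 'rV[R]_n -> R) x :
  analytic_at f x -> analytic_at (fun y => - f y) x.
Proof.
move=> [c [r [r0 cf]]]; exists (fun a => - c a), r; split=> // h /cf[cabs cvf].
split.
  by under [X in box_sum X]eq_fun do rewrite mulNr normrN.
have -> : box_sum (fun a => - c a * monomial h a)
    = (fun N => - box_sum (fun a => c a * monomial h a) N).
  by apply/funext => N; rewrite /box_sum -sumrN; apply: eq_bigr => a _; rewrite mulNr.
exact: cvgN.
Qed.

(** * Power series in the first coordinates *)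

Definition left_index n k (a : {ffun 'I_(n + k) -> nat}) : {ffun 'I_n -> nat} :=
  [ffun i => a (lshift k i)].

Definition right_null n k (a : {ffun 'I_(n + k) -> nat}) : bool :=
  [forall j : 'I_k, a (rshift n j) == 0%N].

(** Extension by zero is a bijection from the multi-indices in n variables onto those in n + k
    variables with null right part. It needs the entry 0, hence a box of positive size. *)
Lemma box_sum_lsubmx n k (u : {ffun 'I_n -> nat} -> R) (N : nat) :
  box_sum (fun a : {ffun 'I_(n + k) -> nat} =>
    if right_null a then u (left_index a) else 0) N.+1 = box_sum u N.+1.
Proof.
rewrite /box_sum -big_mkcond /=.
have [ext extl extr] : exists2 ext :
      {ffun 'I_n -> 'I_N.+1} -> {ffun 'I_(n + k) -> 'I_N.+1},
    forall b i, ext b (lshift k i) = b i & forall b j, ext b (rshift n j) = ord0.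
  exists (fun b => [ffun i => if fintype.split i is inl j then b j else ord0]).
    by move=> b i; rewrite ffunE -[lshift k i]/(unsplit (inl i)) unsplitK.
  by move=> b j; rewrite ffunE -[rshift n j]/(unsplit (inr j)) unsplitK.
pose rst (a : {ffun 'I_(n + k) -> 'I_N.+1}) : {ffun 'I_n -> 'I_N.+1} :=
  [ffun i => a (lshift k i)].
rewrite (reindex_onto ext rst) /=.
  apply: eq_big => [b|b _].
    apply/andP; split.
      by apply/forallP => j; rewrite ffunE extr.
    by apply/eqP/ffunP => i; rewrite ffunE extl.
  by congr u; apply/ffunP => i; rewrite !ffunE extl.
move=> a /forallP a0; apply/ffunP => i.
rewrite -(splitK i); case: (fintype.split i) => j /=; first by rewrite extl ffunE.
by rewrite extr; apply: val_inj; have := a0 j; rewrite ffunE => /eqP.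
Qed.

(** The series of [f] is read in n + k variables, with coefficient 0 on each monomial that involves
    one of the last k. *)
Lemma analytic_at_lsubmx n k (f : 'rV[R]_n -> R) (x : 'rV[R]_(n + k)) :
  analytic_at f (lsubmx x) -> analytic_at (fun y => f (lsubmx y)) x.
Proof.
move=> [c [r [r0 cf]]].
exists (fun a => if right_null a then c (left_index a) else 0), r.
split=> // h hr; have [|cabs cvf] := cf (lsubmx h); first by move=> i; rewrite mxE.
have monoE a : right_null a -> monomial h a = monomial (lsubmx h) (left_index a).
  move=> /forallP a0; rewrite /monomial big_split_ord /= [X in _ * X]big1 => [|j _].
    by rewrite mulr1; apply: eq_bigr => i _; rewrite mxE ffunE.
  by rewrite (eqP (a0 j)) expr0.
split.
  move: cabs => /cvg_ex[l cabs]; apply/cvg_ex; exists l; rewrite -[l]addr0.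
  apply: cvg_shift_eq cabs => N; rewrite addr0.
  rewrite -(@box_sum_lsubmx n k); congr box_sum; apply/funext => a.
  by case: ifP => [/monoE->|]//; rewrite mul0r normr0.
rewrite raddfD -[f _]addr0.
apply: cvg_shift_eq cvf => N; rewrite addr0.
rewrite -(@box_sum_lsubmx n k); congr box_sum; apply/funext => a.
by case: ifP => [/monoE->|]//; rewrite mul0r.
Qed.

Lemma semianalytic_at_void n (E N : set 'rV[R]_n) p :
  nbhs p N -> N `&` E = set0 -> semianalytic_at E p.
Proof.
move=> pN NE; exists N, 0%N, 0%N, (fun _ _ _ => 0), (fun _ _ _ => 0).
by split=> // [[]//|]; rewrite NE; apply/seteqP; split=> // y [_ [[]]].
Qed.

(** The l new inequalities are appended to each term of the union, and paired with the equation 0 =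
    0. *)
Lemma semianalytic_at_cut n l (E E' N : set 'rV[R]_n) p
    (g : 'I_l -> 'rV[R]_n -> R) :
  semianalytic_at E p -> nbhs p N ->
  (forall j y, N y -> analytic_at (g j) y) ->
  N `&` E' = N `&` (E `&` [set y | forall j, 0 < g j y]) ->
  semianalytic_at E' p.
Proof.
move=> [N1 [m [k [f1 [g1 [pN1 an1 EE]]]]]] pN an E'E.
pose f i (j : 'I_(k + l)) y := if fintype.split j is inl j' then f1 i j' y else 0.
pose g' i (j : 'I_(k + l)) y :=
  match fintype.split j with inl j' => g1 i j' y | inr j' => g j' y end.
exists (N1 `&` N), m, (k + l)%N, f, g'; split; first exact: filterI.
  move=> i j y [N1y Ny]; rewrite /f /g'.
  case: (fintype.split j) => j'; first exact: an1.
  by split; [exact: analytic_at_cst|exact: an].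
have EEy y : N1 y -> E y <-> exists i, forall j, f1 i j y = 0 /\ 0 < g1 i j y.
  move=> N1y.
  by split=> H; [suff: (N1 `&` E) y by rewrite EE => -[]
    |suff: (N1 `&` E) y by case]; [|rewrite EE].
have E'y y : N y -> E' y <-> E y /\ forall j, 0 < g j y.
  move=> Ny.
  by split=> H; [suff: (N `&` E') y by rewrite E'E => -[]
    |suff: (N `&` E') y by case]; [|rewrite E'E].
apply/seteqP; split=> y [[N1y Ny]] H; split=> //.
  have [/(EEy _ N1y)[i Hi] gy] := (E'y _ Ny).1 H.
  by exists i => j; rewrite /f /g'; case: (fintype.split j).
have [i Hi] := H; apply/(E'y _ Ny); split.
  apply/(EEy _ N1y); exists i => j; have := Hi (lshift l j).
  by rewrite /f /g' -[lshift l j]/(unsplit (inl j)) unsplitK.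
move=> j; have [_] := Hi (rshift k j).
by rewrite /g' -[rshift k j]/(unsplit (inr j)) unsplitK.
Qed.

End Analytic.

(** * Coordinate cubes *)

Section Cubes.
Context {R : realType} {M : analytic_manifold R}.
Local Notation n := (manifold_dim M).
Implicit Types (phi : @chart R M n) (O A : set M).

(** The image of [O] in the chart contains the preimage of [O] under the continuous inverse, cut by
    the open image of the chart. *)
Lemma nbhs_chart phi O x : open O -> O x -> chart_dom phi x ->
  nbhs (phi x) [set w | exists z, [/\ O z, chart_dom phi z & w = phi z]].
Proof.
move=> oO Ox dx.
have := chart_inv_continuous (c := phi).
rewrite continuous_open_subspace; last exact: chart_img_open.
move=> /(_ (phi x)); rewrite inE => /(_ (ex_intro2 _ _ x dx erefl)) cinv.
have img : nbhs (phi x) (phi @` chart_dom phi).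
  by apply: open_nbhs_nbhs; split; [exact: chart_img_open|exists x].
have pre : nbhs (phi x) (chart_inv phi @^-1` O).
  by apply: cinv; rewrite chart_funK //; exact: open_nbhs_nbhs.
apply: filterS (filterI img pre) => w [[z dz <-]] /=.
by rewrite chart_funK // => Oz; exists z.
Qed.

Lemma nbhs_chart_row phi O x k (y : 'rV[R]_k) :
  open O -> O x -> chart_dom phi x ->
  nbhs (row_mx (phi x) y)
    [set v | exists z, [/\ O z, chart_dom phi z & lsubmx v = phi z]].
Proof.
move=> oO Ox dx; have := nbhs_chart oO Ox dx.
rewrite -{1}(row_mxKl (phi x) y) => H.
exact: (@continuous_lsubmx R 1 n k (row_mx (phi x) y) _ H).
Qed.

Definition cube phi (c : 'rV[R]_n) (r : R) : set M :=
  chart_dom phi `&` [set z | forall i, `|phi z 0 i - c 0 i| < r].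

Lemma open_cube phi c r : open (cube phi c r).
Proof.
rewrite openE => z [dz zr]; apply: filterI.
  by apply: open_nbhs_nbhs; split=> //; exact: chart_dom_open.
have := chart_continuous (c := phi).
rewrite continuous_open_subspace; last exact: chart_dom_open.
move=> /(_ z); rewrite inE => /(_ dz) cz.
apply: (cz [set w : 'rV_n | forall i, `|w 0 i - c 0 i| < r]).
exists (fun i j => [set t : R | `|t - c 0 j| < r]) => [i j|w wr i]; last exact: wr.
rewrite (ord1 i); apply: open_nbhs_nbhs; split; last exact: zr.
have -> : [set t : R | `|t - c 0 j| < r] = ball (c 0 j) r.
  by apply/seteqP; split=> t; rewrite /ball /= distrC.
exact: ball_open.
Qed.

(** At points in the domain of [phi], the cube is given by finitely many strict inequalities between
    analytic functions, since transition maps are analytic. At the other points the closure of the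
    cube is avoided, so the cut set is locally empty. *)
Lemma semianalytic_cube phi c r k (B : set (M * 'rV[R]_k)) :
  atlas phi -> closure (cube phi c r) `<=` chart_dom phi -> semianalytic B ->
  semianalytic (B `&` (cube phi c r `*` setT)).
Proof.
move=> aphi Dphi sB x y psi apsi dx.
have psi_inj z z' : chart_dom psi z -> chart_dom psi z' -> psi z = psi z' -> z = z'.
  by move=> dz dz' e; rewrite -(chart_funK dz) e chart_funK.
have [phix|phix] := pselect (chart_dom phi x); last first.
  have oC : open (~` closure (cube phi c r)) by exact/closed_openC/closed_closure.
  have Cx : (~` closure (cube phi c r)) x by move=> /Dphi.
  apply: semianalytic_at_void (nbhs_chart_row y oC Cx dx) _.
  apply/seteqP; split=> // v [[z [Cz dz vz]]] [[z' y'] [[_ [/= Dz' _]] [/= dz' _]] vE].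
  apply: Cz; rewrite (psi_inj z z') //; first exact: subset_closure.
  by rewrite -vz -vE row_mxKl.
pose N := [set v : 'rV_(n + k) | exists z,
  [/\ chart_dom phi z, chart_dom psi z & lsubmx v = psi z]].
have pN : nbhs (row_mx (psi x) y) N.
  exact: nbhs_chart_row (chart_dom_open phi) phix dx.
pose co i (v : 'rV_(n + k)) : R := phi (chart_inv psi (lsubmx v)) 0 i.
(* Each condition [|phi z 0 i - c 0 i| < r] splits into two strict inequalities, affine in
   [co i]. *)
pose g (j : 'I_(n + n)) v : R := match fintype.split j with
  | inl i => co i v + (r - c 0 i) | inr i => - co i v + (r + c 0 i) end.
have an_co i v : N v -> analytic_at (co i) v.
  move=> [z [phiz psiz vz]].
  apply: (@analytic_at_lsubmx _ _ _ (fun w => phi (chart_inv psi w) 0 i)).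
  rewrite vz.
  exact: atlas_analytic.
apply: (semianalytic_at_cut (g := g) (sB x y psi apsi dx) pN).
  move=> j v Nv; rewrite /g; case: (fintype.split j) => i.
    by apply: analytic_at_addc; exact: an_co.
  by apply: analytic_at_addc; apply: analytic_at_opp; exact: an_co.
have gP v z : chart_dom psi z -> lsubmx v = psi z ->
    (forall j, 0 < g j v) <-> (forall i, `|phi z 0 i - c 0 i| < r).
  move=> dz vz.
  have coE i : co i v = phi z 0 i by rewrite /co vz chart_funK.
  split=> H.
    move=> i; have := H (lshift n i); have := H (rshift n i).
    rewrite /g -[lshift n i]/(unsplit (inl i)) -[rshift n i]/(unsplit (inr i)).
    by rewrite !unsplitK !coE ltr_norml; lra.
  move=> j; rewrite /g; case: (fintype.split j) => i; rewrite coE;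
  by have := H i; rewrite ltr_norml; lra.
apply/seteqP; split=> v [Nv].
  move=> [[z y'] [[Bz [/= [phiz zr] _]] [/= dz _]] vE]; split=> //; split.
    by exists (z, y').
  by apply/(gP v z dz); first by rewrite -vE row_mxKl.
move=> [[[z y'] [Bz [/= dz _]] vE] gv]; split=> //.
have vz : lsubmx v = psi z by rewrite -vE row_mxKl.
exists (z, y') => //=; split; split=> //=; split=> //; split.
  have [z' [phiz' dz' vz']] := Nv.
  by rewrite (psi_inj z z') // -vz.
by apply/(gP v z dz).
Qed.

Lemma semianalytic_setT k : semianalytic [set: M * 'rV[R]_k].
Proof.
move=> x y phi aphi dx.
(* One term of the union with an empty list of conditions describes the whole space. *)
exists [set v | exists z, [/\ setT z, chart_dom phi z & lsubmx v = phi z]], 1%N, 0%N.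
exists (fun _ _ _ => 0), (fun _ _ _ => 0); split=> [|i [] //|].
  exact: nbhs_chart_row openT I dx.
apply/seteqP; split=> v [[z [_ dz vz]] _]; split; try by exists z.
  by exists ord0 => -[].
by exists (z, rsubmx v) => //=; rewrite -vz hsubmxK.
Qed.

(** A local semianalytic lift [B] of [A] is cut by the preimage of the cube, and projection commutes
    with this cut. *)
Lemma subanalyticI_cube phi c r A : atlas phi ->
  closure (cube phi c r) `<=` chart_dom phi -> subanalytic A ->
  subanalytic (A `&` cube phi c r).
Proof.
move=> aphi Dphi sA x; have [N [k [B [xN rB sB AN]]]] := sA x.
exists N, k, (B `&` (cube phi c r `*` setT)); split=> //.
- by apply: rel_compactS rB; exact: subIsetl.
- exact: semianalytic_cube.
rewrite setIAC AN; apply/seteqP; split=> z.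
  by move=> [[w Bw <-] Dw]; exists w.
by move=> [w [Bw [Dw _]] <-]; split=> //; exists w.
Qed.

(** With k = 0 the cube is the projection of its product with a one-point space, which is relatively
    compact like the cube itself. *)
Lemma subanalytic_cube phi c r : atlas phi ->
  closure (cube phi c r) `<=` chart_dom phi -> rel_compact (cube phi c r) ->
  subanalytic (cube phi c r).
Proof.
move=> aphi Dphi rD x.
exists setT, 0%N, (setT `&` (cube phi c r `*` setT)); split.
- by split=> //; exact: openT.
- rewrite setTI /rel_compact.
  have cT : compact [set: 'rV[R]_0].
    have := @rV_compact R 0 (fun=> setT); rewrite (_ : [set v | _] = setT).
      by apply=> -[].
    by apply/seteqP; split=> // v _ [].
  apply: subclosed_compact (compact_setX rD cT) _; first exact: closed_closure.
  move=> z cz; split=> // B /= Bz.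
  have [|w [[Dw _] Bw]] := cz (fst @^-1` B).
    by apply: cvg_fst.
  by exists w.1.
- by apply: semianalytic_cube => //; exact: semianalytic_setT.
by rewrite setTI setIT; apply/seteqP; split=> [z Dz|_ [w [Dw _] <-]//]; exists (z, 0).
Qed.

(** A closed cube in the image of the chart is compact; its image [K] in [M] is compact, hence
    closed because [M] is Hausdorff, and so contains the closure of the open cube. The last clause
    serves to cut any open subanalytic set into relatively compact pieces. *)
Lemma op_sa_base O (x : M) : open O -> O x -> exists D : set M,
  [/\ op_sa D, rel_compact D, D x, closure D `<=` O
    & forall A : set M, op_sa A -> op_sa (A `&` D)].
Proof.
move=> oO Ox; have [phi aphi dx] := atlas_cover x.
have /nbhs_ballP[e /= e0 eO] := nbhs_chart oO Ox dx.
(* Halving the radius keeps the closed cube inside the ball of radius [e]. *)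
pose c := phi x; pose r := e / 2.
have r0 : 0 < r by rewrite divr_gt0.
pose C := [set w : 'rV[R]_n | forall i, `[c 0 i - r, c 0 i + r]%classic (w 0 i)].
have CO w : C w -> exists z, [/\ O z, chart_dom phi z & w = phi z].
  move=> Cw; apply: eO; split=> // i j; rewrite (ord1 i) /ball /=.
  have := Cw j; rewrite /= in_itv /= => /andP[rle ger].
  by rewrite ltr_norml; apply/andP; split; move: rle ger r0; rewrite /r /c; lra.
have cC : compact C.
  have := @rV_compact R _ (fun i => `[c 0 i - r, c 0 i + r]%classic)
    (fun i => @segment_compact R _ _).
  by rewrite (ord1 ord0).
pose K := chart_inv phi @` C.
have cK : compact K.
  apply: continuous_compact cC.
  apply: continuous_subspaceW (chart_inv_continuous (c := phi)).
  by move=> w /CO[z [_ dz ->]]; exists z.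
have kK : closed K by apply: compact_closed cK; exact: manifold_hausdorff.
have KO : K `<=` O `&` chart_dom phi.
  by move=> _ [w /CO[z [Oz dz ->]] <-]; rewrite chart_funK.
have DK : closure (cube phi c r) `<=` K.
  rewrite (closure_id K).1 //; apply: closureS => z [dz zr].
  exists (phi z); last by rewrite chart_funK.
  move=> i; rewrite /= in_itv /=; have := zr i; rewrite ltr_norml => /andP[? ?].
  by apply/andP; split; lra.
have rD : rel_compact (cube phi c r).
  by apply: subclosed_compact cK DK; exact: closed_closure.
have Dphi : closure (cube phi c r) `<=` chart_dom phi.
  by move=> z /DK/KO[].
exists (cube phi c r); split=> //.
- by split; [exact: open_cube|exact: subanalytic_cube].
- by split=> // i; rewrite subrr normr0.
- by move=> z /DK/KO[].
move=> A [oA sA]; split; last exact: subanalyticI_cube.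
by apply: openI => //; exact: open_cube.
Qed.

Lemma op_sa_set0 : op_sa (set0 : set M).
Proof.
split; first exact: open0.
move=> x; exists setT, 0%N, set0; split.
- by split=> //; exact: openT.
- exact: rel_compact_set0.
- move=> x' y phi aphi dx.
  apply: semianalytic_at_void (nbhs_chart_row y openT I dx) _.
  by apply/seteqP; split=> // v [_ [z [z0 _] _]].
- by rewrite set0I image_set0.
Qed.

End Cubes.

(** * Locally finite coverings *)

Section Paracompact.
Context {R : realType} (M : analytic_manifold R).

(** The relatively compact members of a countable base already cover [M]. [D i] is the member with
    code [i] if there is one, and is empty otherwise. *)
Lemma countable_rel_compact_cover : exists D : nat -> set M,
  [/\ forall i, open (D i), forall i, rel_compact (D i) & \bigcup_i D i = setT].
Proof.
have [B cB [oB bB]] := manifold_second_countable M.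
have /countable_injP[f f_inj] := cB.
exists (fun i => \bigcup_(b in [set b | [/\ B b, f b = i & rel_compact b]]) b).
split=> [i|i|]; first by apply: bigcup_open => b [/oB].
  have [[b [Bb fb rb]]|H] := pselect (exists b, [/\ B b, f b = i & rel_compact b]).
    apply: rel_compactS rb => z [b' [Bb' fb' _] b'z].
    by rewrite (f_inj b b') ?inE // fb.
  by apply: rel_compactS (@rel_compact_set0 M) => z [b Hb _]; case: H; exists b.
apply/seteqP; split=> // x _.
have [D [[oD _] rD Dx _ _]] := op_sa_base openT (I : setT x).
have [b [Bb bx] bD] := bB x D (open_nbhs_nbhs (conj oD Dx)).
by exists (f b) => //; exists b => //; split=> //; exact: rel_compactS rD.
Qed.

(** The finite unions [V m] increase to [M]. Since the closure of [V m] is compact, it lies in some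
    later [V p]; iterating this choice gives the exhaustion. *)
Lemma compact_exhaustion : exists O : nat -> set M,
  [/\ O 0%N = set0, forall i, open (O i), forall i, rel_compact (O i),
      forall i, closure (O i) `<=` O i.+1 & \bigcup_i O i = setT].
Proof.
have [D [oD rD DT]] := countable_rel_compact_cover.
pose V m := \bigcup_(i in `I_m) D i.
have oV m : open (V m) by apply: bigcup_open.
have V_mono m p : (m <= p)%N -> V m `<=` V p.
  by move=> mp x [i im Di]; exists i => //; exact: leq_trans mp.
have rV m : rel_compact (V m).
  elim: m => [|m IH].
    by apply: rel_compactS (@rel_compact_set0 M) => x [].
  have -> : V m.+1 = V m `|` D m.
    apply/seteqP; split=> x; last first.
      by move=> [[i im Di]|Dm]; [exists i => //; exact: leqW|exists m => /=].
    move=> [i /=]; rewrite ltnS leq_eqVlt => /predU1P[->|im] Di; first by right.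
    by left; exists i.
  by rewrite /rel_compact closureU; exact: compactU IH (rD m).
have step m : exists p, closure (V m) `<=` V p /\ (m < p)%N.
  have /compact_near_coveringP cov := rV m.
  have Vcov : \forall p \near \oo, closure (V m) `<=` V p.
    apply: (cov nat \oo (fun p x => V p x)) => x _.
    have [i _ Di] : (\bigcup_i D i) x by rewrite DT.
    exists (D i, [set p | (i < p)%N]) => /=.
      by split; [exact: open_nbhs_nbhs|exact: nbhs_infty_gt].
    by move=> [y p] [/= Dy ip]; exists i.
  by have [p [Vp mp]] := filter_ex (filterI Vcov (nbhs_infty_gt m)); exists p.
pose g m := projT1 (cid (step m)).
have gV m : closure (V m) `<=` V (g m) by rewrite /g; case: cid => p [].
have gm m : (m < g m)%N by rewrite /g; case: cid => p [].
exists (fun i => V (iter i g 0%N)); split=> //.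
- by apply/seteqP; split=> // x [].
apply/seteqP; split=> // x _; have [i _ Dx] : (\bigcup_i D i) x by rewrite DT.
(* [D i] enters [V p] as soon as [i < p], and the iterate of order i + 1 of the strictly increasing
   choice [g] exceeds [i]. *)
exists i.+1 => //; exists i => //=; elim: i {Dx} => [|i IH]; first exact: gm.
exact: leq_ltn_trans IH (gm _).
Qed.

(* The cubes chosen around the compact shell between O i and O (i + 1) are
   disjoint from O (i - 1), so O m only meets cubes chosen for i <= m. *)
Lemma locally_finite_cover : exists Q : set (set M),
  [/\ locally_finite Q, \bigcup_(D in Q) D = setT,
      forall D, Q D -> rel_compact D
    & forall D A, Q D -> op_sa A -> op_sa (A `&` D)].
Proof.
(* For i = 0 the predecessor [i.-1] is 0 and [W 0] is empty, so the disjointness required in [P]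
   below is then vacuous. *)
have [W [W0 oW rW WS WT]] := compact_exhaustion.
pose P i := [set D : set M | [/\ rel_compact D,
  forall A, op_sa A -> op_sa (A `&` D) & D `&` W i.-1 = set0]].
have W_mono i j : (i <= j)%N -> W i `<=` W j.
  elim: j => [|j IH]; first by rewrite leqn0 => /eqP ->.
  rewrite leq_eqVlt => /predU1P[->//|/IH ij] x /ij Ox.
  exact/WS/subset_closure.
have shell i : exists Q, [/\ finite_set Q, Q `<=` P i
    & closure (W i.+1) `\` W i `<=` \bigcup_(D in Q) D].
  apply: compact_subcover.
    apply: subclosed_compact (rW i.+1) _; last by move=> x [].
    by apply: closedI; [exact: closed_closure|exact/open_closedC].
  move=> x [_ Ox].
  have Cx : (~` closure (W i.-1)) x.
    by case: i Ox => [|i] Ox /=; [rewrite W0 closure0|move=> /WS].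
  have oC : open (~` closure (W i.-1)) by exact/closed_openC/closed_closure.
  have [D [[oD _] rD Dx DC sD]] := op_sa_base oC Cx.
  exists D; split=> //; split=> //; apply/seteqP; split=> // y [Dy Oy].
  by apply: (DC y); exact: subset_closure.
pose Q i := projT1 (cid (shell i)).
have fQ i : finite_set (Q i) by rewrite /Q; case: cid => ? [].
have QP i : Q i `<=` P i by rewrite /Q; case: cid => ? [].
have QC i : closure (W i.+1) `\` W i `<=` \bigcup_(D in Q i) D.
  by rewrite /Q; case: cid => ? [].
exists (\bigcup_i Q i); split.
- move=> x; have [m _ Ox] : (\bigcup_i W i) x by rewrite WT.
  exists (W m); first exact: open_nbhs_nbhs.
  apply: (sub_finite_set (B := \bigcup_(i in `I_m.+1) Q i)).
    move=> D [[i _ QD] [y [Dy Oy]]]; exists i => //=; rewrite ltnNge; apply/negP => mi.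
    have [_ _ DO] := QP _ _ QD; suff : (D `&` W i.-1) y by rewrite DO.
    by split=> //; apply: W_mono Oy; case: i mi {QD DO}.
  by apply: bigcup_finite => // i _; exact: fQ.
- apply/seteqP; split=> // x _.
  have [m _ Ox] : (\bigcup_i W i) x by rewrite WT.
  (* A point of [W m.+1] is either in [W m], where induction applies, or in the shell of index
     [m]. *)
  elim: m Ox => [|m IH] Ox; first by rewrite W0 in Ox.
  have [/IH//|nOx] := pselect (W m x).
  have [D QD Dx] := QC m x (conj (subset_closure Ox) nOx).
  by exists D => //; exists m.
- by move=> D [i _ /QP[]].
- by move=> D A [i _ /QP[_ sD _]]; exact: sD.
Qed.

End Paracompact.

(** A locally finite covering of [X] cuts [U] into relatively compact pieces, whose products with
    [B] are boxes forming a locally finite family. *)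
Lemma sasa_op_prod (R : realType) (X S : analytic_manifold R)
    (U : set X) (B : set S) : op_sa U -> op_sa B -> rel_compact B ->
  sasa_op (U `*` B).
Proof.
move=> hU hB rB; have [Q [lQ QT rQ sQ]] := locally_finite_cover X.
exists [set (U `&` D) `*` B | D in Q]; split.
- move=> _ [D QD <-]; exists (U `&` D), B; split=> //; split; first exact: sQ.
  by apply: rel_compactS (rQ _ QD); exact: subIsetr.
- move=> [x y]; have [N xN fN] := lQ x.
  exists (N `*` setT); first by exists (N, setT) => //; split=> //; exact: filterT.
  apply: sub_finite_set (finite_image (fun D => (U `&` D) `*` B) fN).
  move=> _ [[D QD <-] [z [[[_ Dz] _] [Nz _]]]].
  by exists D => //; split=> //; exists z.1.
apply/seteqP; split=> [z [Uz Bz]|z [_ [D _ <-] [[]]]//].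
have [D QD Dz] : (\bigcup_(D in Q) D) z.1 by rewrite QT.
by exists ((U `&` D) `*` B); [exists D|].
Qed.


(** * Projective limits of sections *)

Section Limit.
Context {K : comNzRingType} {E : Type} {Y : site E}.
Implicit Type F : presheaf K Y.

(** An explicit model of the projective limit. Its components depend on a proof of [I W], a
    dependence that proof irrelevance makes harmless. *)
Record limit F (I : set (opens Y)) := Limit {
  limit_proj :> forall W, I W -> F W;
  limit_compat : forall (W1 W2 : opens Y) (i1 : I W1) (i2 : I W2)
    (h : W1 `<=` W2), res F h (limit_proj i2) = limit_proj i1 }.

Lemma limit_ext F I (s t : limit F I) : (forall W i, s W i = t W i) -> s = t.
Proof.
case: s t => s hs [t ht] /= st.
have e : s = t by do 2 apply/functional_extensionality_dep => ?.
by case: _ / e ht => ht; congr Limit; exact: Prop_irrelevance.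
Qed.

(** * Module structure on compatible families *)

Section LimitLmodule.
Context (F : presheaf K Y) (I : set (opens Y)).

HB.instance Definition _ := gen_eqMixin (limit F I).
HB.instance Definition _ := gen_choiceMixin (limit F I).

Lemma limit_zero_compat (W1 W2 : opens Y) (i1 : I W1) (i2 : I W2)
  (h : W1 `<=` W2) : res F h 0 = 0.
Proof. exact: linear0. Qed.

Definition limit_zero : limit F I := Limit limit_zero_compat.

Lemma limit_opp_compat (s : limit F I) (W1 W2 : opens Y) (i1 : I W1) (i2 : I W2)
  (h : W1 `<=` W2) : res F h (- s W2 i2) = - s W1 i1.
Proof. by rewrite linearN (limit_compat s i1). Qed.

Definition limit_opp (s : limit F I) : limit F I := Limit (limit_opp_compat s).

Lemma limit_add_compat (s t : limit F I) (W1 W2 : opens Y) (i1 : I W1)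
  (i2 : I W2) (h : W1 `<=` W2) : res F h (s W2 i2 + t W2 i2) = s W1 i1 + t W1 i1.
Proof. by rewrite linearD (limit_compat s i1) (limit_compat t i1). Qed.

Definition limit_add (s t : limit F I) : limit F I := Limit (limit_add_compat s t).

Lemma limit_scale_compat (k : K) (s : limit F I) (W1 W2 : opens Y) (i1 : I W1)
  (i2 : I W2) (h : W1 `<=` W2) : res F h (k *: s W2 i2) = k *: s W1 i1.
Proof. by rewrite linearZ (limit_compat s i1). Qed.

Definition limit_scale (k : K) (s : limit F I) : limit F I :=
  Limit (limit_scale_compat k s).

Fact limit_addA : associative limit_add.
Proof. by move=> s t u; apply: limit_ext => W i; exact: addrA. Qed.

Fact limit_addC : commutative limit_add.
Proof. by move=> s t; apply: limit_ext => W i; exact: addrC. Qed.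

Fact limit_add0 : left_id limit_zero limit_add.
Proof. by move=> s; apply: limit_ext => W i; exact: add0r. Qed.

Fact limit_addN : left_inverse limit_zero limit_opp limit_add.
Proof. by move=> s; apply: limit_ext => W i; exact: addNr. Qed.

HB.instance Definition _ :=
  GRing.isZmodule.Build (limit F I) limit_addA limit_addC limit_add0 limit_addN.

Fact limit_scaleA (k l : K) (s : limit F I) :
  limit_scale k (limit_scale l s) = limit_scale (k * l) s.
Proof. by apply: limit_ext => W i; exact: scalerA. Qed.

Fact limit_scale1 : left_id 1 limit_scale.
Proof. by move=> s; apply: limit_ext => W i; exact: scale1r. Qed.

Fact limit_scaleDr : right_distributive limit_scale +%R.
Proof. by move=> k s t; apply: limit_ext => W i; exact: scalerDr. Qed.

Fact limit_scaleDl (s : limit F I) :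
  {morph limit_scale^~ s : k l / k + l}.
Proof. by move=> k l; apply: limit_ext => W i; exact: scalerDl. Qed.

HB.instance Definition _ := GRing.Zmodule_isLmodule.Build K (limit F I)
  limit_scaleA limit_scale1 limit_scaleDr limit_scaleDl.

End LimitLmodule.

Lemma linear_bundle (L L' : lmodType K) (f : L -> L') : linear f ->
  exists u : {linear L -> L'}, u =1 f.
Proof.
move=> lf; pose a := GRing.isLinear.Build K L L' _ f lf.
by pose u : {linear L -> L'} := HB.pack f a; exists u.
Qed.

Section ProjLim.
Context (F : presheaf K Y) (I : set (opens Y)) (L : lmodType K).
Variable p : forall W, I W -> {linear L -> F W}.
Hypothesis plim : is_proj_lim p.

Lemma proj_lim_inj (x y : L) : (forall W i, @p W i x = @p W i y) -> x = y.
Proof.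
move=> xy; have [z [_ zu]] := plim.2 _ (fun W1 W2 i1 i2 h => plim.1 W1 W2 i1 i2 h y).
by rewrite -(zu x) // (zu y).
Qed.

(** The universal property for linear cones: the map is defined pointwise, and is linear because the
    projections are jointly injective. *)
Lemma proj_lim_lift (L' : lmodType K) (q : forall W, I W -> L' -> F W) :
  (forall W i, linear (q W i)) ->
  (forall (W1 W2 : opens Y) (i1 : I W1) (i2 : I W2) (h : W1 `<=` W2) x,
     res F h (q W2 i2 x) = q W1 i1 x) ->
  exists u : {linear L' -> L}, forall W i x, @p W i (u x) = q W i x.
Proof.
move=> lq cq.
pose u x := projT1 (cid (plim.2 _ (fun W1 W2 i1 i2 h => cq W1 W2 i1 i2 h x))).
have uE W i x : @p W i (u x) = q W i x by rewrite /u; case: cid => t [].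
have ulin : linear u.
  by move=> k x y; apply: proj_lim_inj => W i; rewrite linearP !uE lq.
have [v vE] := linear_bundle ulin.
by exists v => W i x; rewrite vE.
Qed.

End ProjLim.

Lemma proj_lim_bij F I (L L' : lmodType K)
    (p : forall W, I W -> {linear L -> F W})
    (q : forall W, I W -> {linear L' -> F W}) (f : L' -> L) :
  is_proj_lim p -> bijective f -> (forall W i x, q W i x = p W i (f x)) ->
  is_proj_lim q.
Proof.
move=> [pc pu] [g fK gK] qE; split=> [W1 W2 i1 i2 h x|s cs]; first by rewrite !qE pc.
have [x [xs xu]] := pu _ cs; exists (g x); split=> [W i|y ys]; first by rewrite qE gK.
by rewrite (xu (f y)) ?fK // => W i; rewrite -qE.
Qed.

(** Both sections glue the family of restrictions of [s], so the uniqueness in the sheaf axiom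
    identifies them. *)
Lemma sheaf_sep F : is_sheaf F -> forall (W : opens Y) T, site_cov Y W T ->
  (forall A, T A -> A `<=` W) ->
  forall s t : F W, (forall (W' : opens Y) (h : W' `<=` W), T W' ->
    res F h s = res F h t) -> s = t.
Proof.
move=> sF W T cT subT s t st.
(* The sheaf axiom takes a family over all opens; outside [W] the value 0 is a filler. *)
pose v (W' : opens Y) : F W' :=
  if pselect (W' `<=` W) is left h then res F h s else 0.
have vE (W' : opens Y) (h : W' `<=` W) : v W' = res F h s.
  by rewrite /v; case: pselect => // h'; rewrite (Prop_irrelevance h' h).
have cv : forall W1 W2 W' : opens Y, T W1 -> T W2 ->
    forall (h1 : W' `<=` W1) (h2 : W' `<=` W2), res F h1 (v W1) = res F h2 (v W2).
  move=> W1 W2 W' /subT T1 /subT T2 h1 h2.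
  by rewrite !vE !(res_comp _ _ (subset_trans h1 T1)).
have [u [_ uu]] := sF W T cT v cv.
rewrite -(uu s) => [|W' h _]; last by rewrite vE.
by apply: uu => W' h TW'; rewrite vE st.
Qed.

Lemma sheaf_glue F : is_sheaf F -> forall (W : opens Y) T, site_cov Y W T ->
  forall s : (forall W' : opens Y, T W' -> F W'),
    (forall (W1 W2 W' : opens Y) (T1 : T W1) (T2 : T W2)
       (h1 : W' `<=` W1) (h2 : W' `<=` W2),
       res F h1 (s W1 T1) = res F h2 (s W2 T2)) ->
  exists t : F W, forall (W' : opens Y) (h : W' `<=` W) (TW : T W'),
    res F h t = s W' TW.
Proof.
move=> sF W T cT s cs.
pose v (W' : opens Y) : F W' := if pselect (T W') is left h then s W' h else 0.
have vE (W' : opens Y) (h : T W') : v W' = s W' h.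
  by rewrite /v; case: pselect => // h'; rewrite (Prop_irrelevance h' h).
have cv : forall W1 W2 W' : opens Y, T W1 -> T W2 ->
    forall (h1 : W' `<=` W1) (h2 : W' `<=` W2), res F h1 (v W1) = res F h2 (v W2).
  by move=> W1 W2 W' T1 T2 h1 h2; rewrite !vE; exact: cs.
have [u [tu _]] := sF W T cT v cv.
by exists u => W' h TW; rewrite tu // vE.
Qed.

(** * Sections as limits over a covering that is monotone in the open set *)

Section Base.
Variable base : set E -> set (set E).
Hypothesis base_cov : forall W : opens Y, site_cov Y W (base W).
Hypothesis base_sub : forall W A, base W A -> A `<=` W.
Hypothesis base_mono : forall W W', W' `<=` W -> base W' `<=` base W.

Definition base_opens (W : set E) : set (opens Y) := [set P | base W P].

Lemma base_sep F : is_sheaf F -> forall (W : opens Y) (s t : F W),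
  (forall (P : opens Y) (h : P `<=` W), base W P -> res F h s = res F h t) ->
  s = t.
Proof. by move=> sF W s t; apply: (sheaf_sep sF (base_cov W)) => A /base_sub. Qed.

(** An open inside two members is covered by its own base, whose members belong to [base W] by
    monotonicity. Compatibility along inclusions therefore gives agreement on overlaps. *)
Lemma sheaf_proj_lim F : is_sheaf F -> forall W : opens Y,
  is_proj_lim (fun P (i : base_opens W P) => res F (base_sub i)).
Proof.
move=> sF W; split=> [W1 W2 i1 i2 h x|s cs]; first exact: res_comp.
have [W1 W2 W' i1 i2 h1 h2|t ts] := sheaf_glue sF (base_cov W) (s := s).
  apply: base_sep => // P h bP.
  have bWP : base_opens W P by apply: base_mono bP => x /h1; exact: base_sub i1 _.
  rewrite !(res_comp _ _ (subset_trans h h1)) !(res_comp _ _ (subset_trans h h2)).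
  by rewrite (cs _ _ bWP) (cs _ _ bWP).
exists t; split=> [P i|u us]; first exact: ts.
apply: base_sep => // P h bP.
by rewrite (ts _ _ bP) -us (Prop_irrelevance h (base_sub bP)).
Qed.

End Base.

End Limit.

(** * Boxes as coverings *)

Section Core.
Context {R : realType} {X S : analytic_manifold R}.
Implicit Types (W P : set (X * S)).

Definition boxes W : set (set (X * S)) := [set P | sasa_box P /\ P `<=` W].

(* [core W] consists of the boxes A x B such that A x cl(B) lies in W; when W is
   a finite union of products, an open V as below then exists. *)
Definition core W : set (set (X * S)) :=
  [set P | exists A B V, [/\ op_sa A /\ rel_compact A, op_sa B /\ rel_compact B,
     open V /\ closure B `<=` V, A `*` V `<=` W & P = A `*` B]].

Lemma core_box W P : core W P -> sasa_box P.
Proof. by move=> [A [B [V [? ? _ _ ->]]]]; exists A, B. Qed.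

Lemma core_sub W P : core W P -> P `<=` W.
Proof.
move=> [A [B [V [_ _ [_ BV] AVW ->]]]] z [Az Bz]; apply: AVW; split=> //.
exact/BV/subset_closure.
Qed.

Lemma core_mono W W' : W' `<=` W -> core W' `<=` core W.
Proof.
move=> W'W P [A [B [V [? ? ? AVW ->]]]]; exists A, B, V; split=> //.
exact: subset_trans W'W.
Qed.

(** A point of [Q] turns the inclusion of products into inclusions of the factors; the same [V] then
    serves for [Q]. *)
Lemma core_boxes W P Q : core W P -> sasa_box Q -> Q !=set0 -> Q `<=` P ->
  core W Q.
Proof.
move=> [A [B [V [_ _ [oV BV] AVW ->]]]] [A' [B' [hA' hB' ->]]] [[a b] [/= A'a B'b]] sub.
exists A', B', V; split=> //.
  split=> //; apply: subset_trans BV; apply: closureS => y B'y.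
  by have [] := sub (a, y) (conj A'a B'y).
by move=> [x y] [/= A'x Vy]; apply: AVW; split=> //; case: (sub (x, b) (conj A'x B'b)).
Qed.

(** The product of [A] with the intersection of the two open sets [V] and [V'] works; the factors
    can be compared because [P] is not empty. *)
Lemma core_prodI W1 W2 P : P !=set0 -> core W1 P -> core W2 P ->
  exists W, [/\ rel_op W, W `<=` W1, W `<=` W2 & core W P].
Proof.
move=> P0 [A [B [V [hA hB [oV BV] AVW e]]]] [A' [B' [V' [_ _ [oV' BV'] AVW' e']]]].
have [[a b] Pab] := P0.
have [AA BB] : A `<=` A' /\ B `<=` B'.
  have [Aa Bb] : A a /\ B b by rewrite e in Pab.
  split=> [x Ax|y By].
    have : P (x, b) by rewrite e.
    by rewrite e' => -[].
  have : P (a, y) by rewrite e.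
  by rewrite e' => -[].
exists (A `*` (V `&` V')); split.
- by apply: rel_op_prod; [case: hA|exact: openI].
- by apply: subset_trans AVW => z [? []].
- by apply: subset_trans AVW' => z [? []]; split=> //; exact: AA.
- exists A, B, (V `&` V'); split=> //; split; first exact: openI.
  by rewrite subsetI; split=> //; apply: subset_trans BV'; exact: closureS.
Qed.

Lemma sasa_box_op P : sasa_box P -> sasa_op P.
Proof.
move=> hP; exists [set P]; split; [by move=> _ ->| |by rewrite bigcup_set1].
move=> x; exists setT; first exact: filterT.
by apply: sub_finite_set (finite_set1 P) => A [].
Qed.

Lemma boxes_cov (W : opens (site_sasa X S)) : site_cov (site_sasa X S) W (boxes W).
Proof.
split=> [P []|P []|P hP PW] //; first by move=> /sasa_box_op.
exists [set P]; split; [exact: finite_set1| |by rewrite bigcup_set1].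
by move=> _ ->; exists P => //; rewrite setIid.
Qed.

Lemma boxes_sub W P : boxes W P -> P `<=` W. Proof. by case. Qed.

Lemma boxes_mono W W' : W' `<=` W -> boxes W' `<=` boxes W.
Proof. by move=> W'W P [hP PW']; split=> //; exact: subset_trans W'W. Qed.

(** A compact set meets [U] inside finitely many pieces [U] [&] [D], with [D] a relatively compact
    set from [op_sa_base]. *)
Lemma op_sa_cover (U : set X) : op_sa U ->
  cover_sa U [set A | (op_sa A /\ rel_compact A) /\ A `<=` U].
Proof.
move=> hU; split=> [A [[]]|A []|K cK] //.
pose P := [set D : set X | [/\ op_sa D, rel_compact D
  & forall A : set X, op_sa A -> op_sa (A `&` D)]].
have [|Q [fQ QP KQ]] := @compact_subcover _ K P cK.
  move=> x Kx; have [D [oD rD Dx _ sD]] := op_sa_base openT (I : setT x).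
  by exists D; split=> //; case: oD.
exists [set U `&` D | D in Q]; split; first exact: finite_image.
  move=> _ [D /QP[hD rD sD] <-]; split; last exact: subIsetl.
  split; first exact: sD.
  by apply: rel_compactS rD; exact: subIsetr.
apply/seteqP; split=> x [Kx].
  by move=> [_ [D _ <-] [Ux _]]; split.
move=> Ux; split=> //; have [D QD Dx] := KQ _ Kx.
by exists (U `&` D); first by exists D.
Qed.

(** On a product U x V inside [W], the refinement pairs relatively compact [A] inside [U] with [B]
    whose closure lies in [V]; [V] itself is the open set required by [core]. *)
Lemma core_cov (W : opens (site_rel X S)) : site_cov (site_rel X S) W (core W).
Proof.
split=> [P|P|U V hU hV UVW].
- by move=> /core_box[A [B [[? _] [[? _] _] ->]]]; exact: rel_op_prod.
- exact: core_sub.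
exists [set A | (op_sa A /\ rel_compact A) /\ A `<=` U],
  [set B | (op_sa B /\ rel_compact B) /\ closure B `<=` V].
split; [exact: op_sa_cover|split=> [B [[[]]]//|]|].
  apply/seteqP; split=> x.
    by move=> [B [_ BV]] Bx; exact/BV/subset_closure.
  by move=> /(op_sa_base hV)[D [? ? ? ? _]]; exists D.
move=> A B [hA AU] [hB BV]; exists (A `*` B) => //.
exists (A `*` B); last first.
  apply: setIidl => z [Az Bz]; split; [exact: AU|exact/BV/subset_closure].
exists A, B, V; split=> //; apply: subset_trans UVW => z [Az Vz].
by split=> //; exact: AU.
Qed.

(* The compactness of cl(A') and cl(B) makes finitely many products A1 x (B /\ D1)
   sufficient to cover each box A' x B' inside P = A x B. *)
Lemma core_refine (W : opens (site_rel X S)) (T : set (set (X * S)))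
    (P : set (X * S)) : site_cov (site_rel X S) W T -> core W P ->
  site_cov (site_sasa X S) P
    [set Q | Q `<=` P /\ exists2 W', T W' & core W' Q].
Proof.
move=> [Top _ Tcov] [A [B [V [[hA rA] [hB rB] [oV BV] AVW PE]]]].
split=> [Q [_ [W' _ /core_box/sasa_box_op]]|Q []|P' [A' [B' [[hA' rA'] _ P'E]]] P'P] //.
(* The covering is read on the product A x V supplied by [core], where [V] contains the closure of
   [B]. *)
have [Sig [C [[Sop Ssub Scov] [Cop CV] SC]]] := Tcov A V hA oV AVW.
have [[[a b] P'ab]|P'0] := pselect (P' !=set0); last first.
  exists set0; split=> //; rewrite bigcup_set0; apply/seteqP; split=> // z Pz.
  by case: P'0; exists z.
have [AA BB] : A' `<=` A /\ B' `<=` B.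
  have [Aa Bb] : A' a /\ B' b by rewrite P'E in P'ab.
  split=> [x Ax|y By].
    have : P (x, b) by apply: P'P; rewrite P'E.
    by rewrite PE => -[].
  have : P (a, y) by apply: P'P; rewrite P'E.
  by rewrite PE => -[].
have [Sig0 [fS0 S0S S0A]] := Scov _ rA'.
(* The member [V'] of [C] containing the closure of such a set is the open set that [core] will
   require. *)
pose D := [set D : set S | op_sa (B `&` D) /\ exists2 V', C V' & closure D `<=` V'].
have [|D0 [fD0 D0D BD0]] := @compact_subcover _ _ D rB.
  move=> y /BV; rewrite -CV => -[V' CV' V'y].
  have [E [[oE _] _ Ey EV' hE]] := op_sa_base (Cop _ CV') V'y.
  by exists E; split=> //; split; [exact: hE|exists V'].
exists [set Z.1 `*` (B `&` Z.2) `&` P' | Z in Sig0 `*` D0]; split.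
- by apply: finite_image; exact: finite_setX.
- move=> _ [[A1 D1] [/= S0A1 D0D1] <-].
  exists (A1 `*` (B `&` D1)) => //=.
  have [hD1 [V' CV' D1V']] := D0D _ D0D1.
  have A1A := Ssub _ (S0S _ S0A1).
  split; first by rewrite PE => z [? []]; split=> //; exact: A1A.
  have [_ [W' TW' <-] sW'] := SC _ _ (S0S _ S0A1) CV'.
  exists W' => //; exists A1, (B `&` D1), V'; split=> //.
  + by split; [exact: Sop (S0S _ S0A1)|exact: rel_compactS rA].
  + by split=> //; apply: rel_compactS rB; exact: subIsetl.
  + split; first exact: Cop.
    by apply: subset_trans D1V'; apply: closureS; exact: subIsetr.
  + by apply: subset_trans sW' _; exact: subIsetl.
apply/seteqP; split=> [z [_ [Z _ <-] []]//|z P'z].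
have [A'z B'z] : A' z.1 /\ B' z.2 by rewrite P'E in P'z.
have [A1 S0A1 A1z] : (\bigcup_(A1 in Sig0) A1) z.1.
  suff : (closure A' `&` \bigcup_(A1 in Sig0) A1) z.1 by case.
  by rewrite S0A; split; [exact: subset_closure|exact: AA].
have [D1 D0D1 D1z] := BD0 _ (subset_closure (BB _ B'z)).
exists (A1 `*` (B `&` D1) `&` P'); first by exists (A1, D1).
by split=> //; split=> //; split=> //; exact: BB.
Qed.

End Core.

Section LimitRestrict.
Context {K : comNzRingType} {E : Type} {Y : site E} (F : presheaf K Y).
Context {I J : set (opens Y)} (h : I `<=` J).

Lemma limit_restrict_compat (s : limit F J) (W1 W2 : opens Y) (i1 : I W1)
  (i2 : I W2) (h12 : W1 `<=` W2) : res F h12 (s W2 (h i2)) = s W1 (h i1).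
Proof. exact: limit_compat. Qed.

Definition limit_restrict (s : limit F J) : limit F I :=
  Limit (limit_restrict_compat s).

Fact limit_restrict_is_linear : linear limit_restrict.
Proof. by move=> k s t; exact: limit_ext. Qed.

HB.instance Definition _ := GRing.isLinear.Build K (limit F J) (limit F I)
  _ limit_restrict limit_restrict_is_linear.

End LimitRestrict.

(** * The sheaf of limits over boxes *)

Section CoreSheaf.
Context {R : realType} {X S : analytic_manifold R} {K : comNzRingType}.
Variables (F : presheaf K (site_sasa X S)).
Local Notation core_opens W := (base_opens (Y := site_sasa X S) core W).

Lemma core_opens_mono (W W' : set (X * S)) :
  W' `<=` W -> core_opens W' `<=` core_opens W.
Proof. by move=> h P; exact: core_mono. Qed.

Definition core_sections (W : opens (site_rel X S)) : lmodType K :=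
  limit F (core_opens W).

Definition core_res (W' W : opens (site_rel X S)) (h : W' `<=` W) :
  {linear core_sections W -> core_sections W'} := limit_restrict (core_opens_mono h).

Lemma core_resE (W' W : opens (site_rel X S)) (h : W' `<=` W)
    (s : core_sections W) P (c' : core_opens W' P) (c : core_opens W P) :
  core_res h s P c' = s P c.
Proof. by rewrite (Prop_irrelevance c (core_opens_mono h c')). Qed.

Lemma core_res_id (W : opens (site_rel X S)) (h : W `<=` W) s : core_res h s = s.
Proof. by apply: limit_ext => P c; exact: core_resE. Qed.

Lemma core_res_comp (W'' W' W : opens (site_rel X S)) (h'' : W'' `<=` W')
    (h' : W' `<=` W) (h : W'' `<=` W) s :
  core_res h'' (core_res h' s) = core_res h s.
Proof.
apply: limit_ext => P c; have c' := core_opens_mono h'' c.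
by rewrite (core_resE _ _ _ c') !(core_resE _ _ _ (core_opens_mono h c)).
Qed.

Definition core_presheaf : presheaf K (site_rel X S) :=
  Presheaf core_res_id core_res_comp.

Hypothesis sF : is_sheaf F.

Let boxes_sepF := base_sep (@boxes_cov R X S) (@boxes_sub R X S) sF.

(** The empty family covers an empty open, so separation identifies all its sections. *)
Lemma sections_empty (P : opens (site_sasa X S)) (s t : F P) :
  ~ ((P : set (X * S)) !=set0) -> s = t.
Proof.
move=> P0; apply: (sheaf_sep sF (T := set0)) => //.
split=> // Q _ QP; exists set0; split=> //.
rewrite bigcup_set0; apply/seteqP; split=> // z Qz.
by apply: P0; exists z; exact: QP.
Qed.

(* Two boxes of cores of W1 and W2 overlap in boxes of the core of a product
   contained in both W1 and W2. *)
Lemma core_glue_compat (T : set (set (X * S)))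
    (s : forall W : opens (site_rel X S), core_presheaf W) :
  (forall W1 W2 W' : opens (site_rel X S), T W1 -> T W2 ->
     forall (h1 : W' `<=` W1) (h2 : W' `<=` W2),
     res core_presheaf h1 (s W1) = res core_presheaf h2 (s W2)) ->
  forall (W1 W2 : opens (site_rel X S)) (Q1 Q2 Q : opens (site_sasa X S))
    (c1 : core_opens W1 Q1) (c2 : core_opens W2 Q2)
    (h1 : Q `<=` Q1) (h2 : Q `<=` Q2),
  T W1 -> T W2 -> res F h1 (s W1 Q1 c1) = res F h2 (s W2 Q2 c2).
Proof.
move=> cs W1 W2 Q1 Q2 Q c1 c2 h1 h2 T1 T2.
apply: boxes_sepF => P h [bP _].
have [P0|] := pselect ((P : set (X * S)) !=set0); last exact: sections_empty.
have hP1 := subset_trans h h1; have hP2 := subset_trans h h2.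
have d1 : core_opens W1 P := core_boxes c1 bP P0 hP1.
have d2 : core_opens W2 P := core_boxes c2 bP P0 hP2.
rewrite !(res_comp _ _ hP1) !(res_comp _ _ hP2).
rewrite (limit_compat _ d1) (limit_compat _ d2).
have [W [oW WW1 WW2 cW]] := core_prodI P0 d1 d2.
pose W' : opens (site_rel X S) := exist _ W oW.
rewrite -(@core_resE W' W1 WW1 _ _ cW) -(@core_resE W' W2 WW2 _ _ cW).
have e : @core_res W' W1 WW1 (s W1) = @core_res W' W2 WW2 (s W2).
  exact: cs W1 W2 W' T1 T2 WW1 WW2.
by rewrite e.
Qed.

(** Over each box [P] of the core of [W], the boxes inside [P] that lie in the core of a member of
    [T] form a covering, by [core_refine]. The given sections glue there, and separation makes the
    glued sections compatible. *)
Lemma core_is_sheaf : is_sheaf core_presheaf.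
Proof.
move=> W T cT s cs.
have TW W' : T W' -> W' `<=` W by case: cT => _ + _; exact.
have Top W' : T W' -> site_op (site_rel X S) W' by case: cT => + _ _; exact.
pose small (P : opens (site_sasa X S)) :=
  [set Q : set (X * S) | Q `<=` P /\ exists2 W', T W' & core W' Q].
have small_cov P (c : core_opens W P) : site_cov (site_sasa X S) P (small P).
  exact: core_refine cT c.
have wit P (Q : opens (site_sasa X S)) : small P Q ->
    exists W' : opens (site_rel X S), T W' /\ core_opens W' Q.
  by move=> [_ [W' TW' cW']]; exists (exist _ W' (Top _ TW')).
(* A small box may lie in the core of several members of [T]; one is chosen, and [core_glue_compat]
   makes the choice immaterial. *)
pose w P (Q : opens (site_sasa X S)) (i : small P Q) := projT1 (cid (wit P Q i)).
have wT P (Q : opens (site_sasa X S)) (i : small P Q) : T (w P Q i).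
  by rewrite /w; case: cid => ? [].
have wc P (Q : opens (site_sasa X S)) (i : small P Q) : core_opens (w P Q i) Q.
  by rewrite /w; case: cid => ? [].
have glue P (c : core_opens W P) : exists t : F P,
    forall (W' : opens (site_rel X S)) (Q : opens (site_sasa X S))
      (h : Q `<=` P) (c' : core_opens W' Q), T W' -> res F h t = s W' Q c'.
  have [|t ts] := sheaf_glue sF (small_cov P c)
      (s := fun Q i => s (w P Q i) Q (wc P Q i)).
    by move=> *; apply: core_glue_compat cs _ _ _ _ _ _ _ _ _ _ _; exact: wT.
  exists t => W' Q h c' TW'.
  have i : small P Q by split=> //; exists W'.
  (* Restrictions from [Q] to itself are inserted to reach the form treated by
     [core_glue_compat]. *)
  rewrite (ts Q h i) -[LHS](res_id (@subset_refl _ Q)).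
  rewrite -[RHS](res_id (@subset_refl _ Q)).
  by apply: core_glue_compat cs _ _ _ _ _ _ _ _ _ _ _ => //; exact: wT.
have small_sep P (c : core_opens W P) (t t' : F P) :
    (forall (W' : opens (site_rel X S)) (Q : opens (site_sasa X S))
      (h : Q `<=` P), core_opens W' Q -> T W' -> res F h t = res F h t') -> t = t'.
  move=> tt'; apply: (sheaf_sep sF (small_cov P c)) => [A []//|Q h i].
  exact: tt' (wc P Q i) (wT P Q i).
pose t P c := projT1 (cid (glue P c)).
have tE (P : opens (site_sasa X S)) c (W' : opens (site_rel X S))
    (Q : opens (site_sasa X S)) (h : Q `<=` P) (c' : core_opens W' Q) :
    T W' -> res F h (t P c) = s W' Q c'.
  by rewrite /t; case: cid => /= ? +; exact.
have ct (P1 P2 : opens (site_sasa X S)) (c1 : core_opens W P1)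
    (c2 : core_opens W P2) (h : P1 `<=` P2) : res F h (t P2 c2) = t P1 c1.
  apply: (small_sep P1 c1) => W' Q h' c' TW'.
  by rewrite (res_comp _ _ (subset_trans h' h)) !(tE _ _ W' Q _ c').
exists (Limit ct); split=> [W' h TW'|t' t's].
  apply: limit_ext => P c; have c' := core_opens_mono h c.
  rewrite [LHS](core_resE h (Limit ct : core_sections W) c c') /=.
  (* Here [P] lies in the core of the member [W'], so the gluing property applies with [Q] equal to
     [P]. *)
  by rewrite -(tE P c' W' P (@subset_refl _ P) c TW') res_id.
apply: limit_ext => P c /=; apply: (small_sep P c) => W' Q h c' TW'.
rewrite (tE _ _ W' Q _ c') // -(t's W' (TW _ TW') TW') /=.
exact/esym/limit_compat.
Qed.

End CoreSheaf.

(** * The inverse image *)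

Section PresheafHoms.
Context {K : comNzRingType} {E : Type} {Y : site E}.

Lemma id_hom_nat (F : presheaf K Y) (W' W : opens Y) (h : W' `<=` W) s :
  res F h ((idfun : {linear F W -> F W}) s)
  = (idfun : {linear F W' -> F W'}) (res F h s).
Proof. by []. Qed.

Definition id_hom (F : presheaf K Y) : presheaf_hom F F :=
  PresheafHom (@id_hom_nat F).

Lemma comp_hom_nat (F G H : presheaf K Y) (g : presheaf_hom G H)
    (f : presheaf_hom F G) (W' W : opens Y) (h : W' `<=` W) s :
  res H h ((g W \o f W : {linear F W -> H W}) s)
  = (g W' \o f W' : {linear F W' -> H W'}) (res F h s).
Proof. by rewrite /= hom_nat hom_nat. Qed.

Definition comp_hom (F G H : presheaf K Y) (g : presheaf_hom G H)
  (f : presheaf_hom F G) : presheaf_hom F H := PresheafHom (comp_hom_nat g f).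

End PresheafHoms.

Section CoreInverseImage.
Context {R : realType} {X S : analytic_manifold R} {K : comNzRingType}.
Variables (F : presheaf K (site_sasa X S)).
Hypothesis sF : is_sheaf F.
Local Notation core_opens W := (base_opens (Y := site_sasa X S) core W).

Section CoreCross.
Variables (W : opens (site_rel X S)) (W' : opens (site_sasa X S)) (h : W `<=` W').

Lemma core_sub_trans (P : opens (site_sasa X S)) : core_opens W P -> P `<=` W'.
Proof. by move=> c; apply: subset_trans h; exact: core_sub. Qed.

Lemma core_cross_compat (s : F W') (P1 P2 : opens (site_sasa X S))
    (c1 : core_opens W P1) (c2 : core_opens W P2) (h12 : P1 `<=` P2) :
  res F h12 (res F (core_sub_trans c2) s) = res F (core_sub_trans c1) s.
Proof. exact: res_comp. Qed.

Definition core_cross_sec (s : F W') : core_presheaf F W :=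
  Limit (core_cross_compat s).

Fact core_cross_is_linear : linear core_cross_sec.
Proof. by move=> k s t; apply: limit_ext => P c; exact: linearP. Qed.

HB.instance Definition _ := GRing.isLinear.Build K (F W') (core_presheaf F W)
  _ core_cross_sec core_cross_is_linear.

End CoreCross.

Lemma core_cross_natl (W1 W2 : opens (site_rel X S)) (W' : opens (site_sasa X S))
    (h : W1 `<=` W2) (h1 : W1 `<=` W') (h2 : W2 `<=` W') s :
  res (core_presheaf F) h (core_cross_sec h2 s) = core_cross_sec h1 s.
Proof.
apply: limit_ext => P c /=; congr (res F _ s); exact: Prop_irrelevance.
Qed.

Lemma core_cross_natr (W : opens (site_rel X S)) (W1 W2 : opens (site_sasa X S))
    (h : W1 `<=` W2) (h1 : W `<=` W1) (h2 : W `<=` W2) s :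
  core_cross_sec h1 (res F h s) = core_cross_sec h2 s.
Proof. by apply: limit_ext => P c /=; exact: res_comp. Qed.

Definition core_cross : cross_hom F (core_presheaf F) :=
  CrossHom core_cross_natl core_cross_natr.

Definition box_sasa W (P : opens (site_rel X S)) (c : core W P) :
  opens (site_sasa X S) := exist _ (P : set (X * S)) (sasa_box_op (core_box c)).

Variables (G : presheaf K (site_rel X S)) (eta : cross_hom F G).

Section CoreGlue.
Hypothesis sG : is_sheaf G.

(* The boxes of the core of W are opens of both sites and cover W. *)
Lemma core_glue : exists phi : presheaf_hom (core_presheaf F) G,
  forall (W P : opens (site_rel X S)) (c : core W P) (h : P `<=` W)
    (s : core_sections F W),
  res G h (phi W s) = eta P (box_sasa c) (@subset_refl _ P) (s (box_sasa c) c).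
Proof.
have cov := @core_cov R X S; have sub := @core_sub R X S.
have mono := @core_mono R X S.
pose q (W P : opens (site_rel X S)) (c : base_opens core W P)
    (s : core_sections F W) : G P :=
  eta P (box_sasa c) (@subset_refl _ P) (s (box_sasa c) c).
have q_lin W P c : linear (@q W P c).
  by move=> k s t; rewrite /q -linearP.
(* By naturality of [eta], [q] can be computed from any larger box of the core. *)
have qE (W P : opens (site_rel X S)) (c : base_opens core W P)
    (P' : opens (site_sasa X S)) (c' : core W P') (h : P `<=` P') s :
    q W P c s = eta P P' h (s P' c').
  rewrite /q -(@limit_compat _ _ _ _ _ s (box_sasa c) P' c c' h).
  exact: cross_natr.
have q_compat (W P1 P2 : opens (site_rel X S)) (c1 : base_opens core W P1)
    (c2 : base_opens core W P2) (h : P1 `<=` P2) s :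
    res G h (q W P2 c2 s) = q W P1 c1 s.
  rewrite /q (cross_natl eta h (h : P1 `<=` box_sasa c2)).
  by rewrite -(qE W P1 c1).
have lift W := proj_lim_lift (sheaf_proj_lim cov sub mono sG W)
  (@q_lin W) (@q_compat W).
pose u W := projT1 (cid (lift W)).
have uE (W P : opens (site_rel X S)) (c : base_opens core W P) (h : P `<=` W) s :
    res G h (u W s) = q W P c s.
  by rewrite /u; case: cid => v /= <-; rewrite (Prop_irrelevance h (sub _ _ c)).
have u_nat (W' W : opens (site_rel X S)) (h : W' `<=` W) s :
    res G h (u W s) = u W' (res (core_presheaf F) h s).
  apply: (base_sep cov sub sG) => P hP c.
  have c' : base_opens core W P := mono _ _ h _ c.
  rewrite (res_comp _ _ (subset_trans hP h)) (uE W P c') (uE W' P c).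
  rewrite (qE W P c' (box_sasa c) c' (@subset_refl _ P)) /q.
  by congr (eta _ _ _ _); rewrite (@core_resE _ _ _ _ _ _ _ h s (box_sasa c) c c').
by exists (@PresheafHom K _ _ (core_presheaf F) G u u_nat) => W P c h s; exact: uE.
Qed.

End CoreGlue.

Hypothesis hG : is_inverse_image eta.

(** [phi] after [psi] preserves [eta], hence is the identity by the uniqueness in the universal
    property. [psi] after [phi] is the identity because it is so over the boxes of the core, which
    separate sections. *)
Theorem inverse_image_core : exists psi : presheaf_hom G (core_presheaf F),
  (forall (W : opens (site_rel X S)) (W' : opens (site_sasa X S))
     (h : W `<=` W') s, psi W (eta W W' h s) = core_cross W W' h s) /\
  forall W, bijective (psi W).
Proof.
have [sG uG] := hG.
have [[psi psiE] _] := uG _ core_cross (core_is_sheaf sF).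
have [phi phiE] := core_glue sG.
have cov := @core_cov R X S; have sub := @core_sub R X S.
have mono := @core_mono R X S.
exists psi; split=> // W; exists (phi W) => s.
  have [_ uniq] := uG _ eta sG.
  apply: (uniq (comp_hom phi psi) (id_hom G)) => {}W W' h {}s /=.
  rewrite psiE; apply: (base_sep cov sub sG) => P hP c.
  rewrite (phiE _ _ c) (cross_natl _ hP (subset_trans hP h)).
  exact: cross_natr.
apply: (base_sep cov sub (core_is_sheaf sF)) => P hP c.
rewrite hom_nat (phiE _ _ c) psiE; apply: limit_ext => Q d.
rewrite (core_resE hP s d (core_opens_mono hP d)) /=.
exact: limit_compat.
Qed.

End CoreInverseImage.

(** * Sections over a product *)

Section Slices.
Context {R : realType} {X S : analytic_manifold R} {K : comNzRingType}.
Context {F : presheaf K (site_sasa X S)}.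
Hypothesis sF : is_sheaf F.
Context {U : set X} {V : set S}.
Hypotheses (hU : op_sa U) (hV : open V).
Local Notation UV := (rel_prod hU hV).
Local Notation core_opens W := (base_opens (Y := site_sasa X S) core W).
Local Notation boxes_opens W := (base_opens (Y := site_sasa X S) boxes W).

(** For a nonempty box A x B in U x V', the closure of [B] lies in that of [V'], hence in [V], which
    serves as the open set in [core]. *)
Lemma slice_boxes_core (W : opens (site_sasa X S)) : slices U V W ->
  boxes_opens W `<=` core_opens UV.
Proof.
move=> [V' [hV' [_ V'V] ->]] P [[A [B [hA hB PE]]] PW].
have [[[a b] Pab]|P0] := pselect ((P : set (X * S)) !=set0).
  have [Aa Bb] : A a /\ B b by rewrite PE in Pab.
  exists A, B, V; split=> //.
    split=> //; apply: subset_trans V'V; apply: closureS => y By.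
    by have [] : (U `*` V') (a, y) by apply: PW; rewrite PE.
  move=> [x y] [/= Ax Vy]; split=> //=.
  by have [] : (U `*` V') (x, b) by apply: PW; rewrite PE.
(* If one factor of an empty box is empty, the other is unconstrained by [V]; the box is therefore
   rewritten with both factors empty. *)
exists set0, set0, set0; split.
- by split; [exact: op_sa_set0|exact: rel_compact_set0].
- by split; [exact: op_sa_set0|exact: rel_compact_set0].
- by split; [exact: open0|rewrite closure0].
- by move=> z [].
- by apply/seteqP; split=> [z Pz|z []//]; case: P0; exists z.
Qed.

(** A nonempty box A x B of the core lies in the slice U x B; an empty one lies in the slice over
    the empty set. *)
Lemma core_in_slice (P : opens (site_sasa X S)) : core_opens UV P ->
  exists W, slices U V W /\ P `<=` W.
Proof.
move=> [A [B [V' [hA [hB rB] [oV' BV'] AVUV PE]]]].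
have [[[a b] Pab]|P0] := pselect ((P : set (X * S)) !=set0).
  have [Aa Bb] : A a /\ B b by rewrite PE in Pab.
  exists (exist _ (U `*` B) (sasa_op_prod hU hB rB)); split.
    exists B; split=> //; split=> // y By.
    by have [] := AVUV (a, y) (conj Aa (BV' _ By)).
  rewrite PE => -[x y] [/= Ax By]; split=> //=.
  by have [] := AVUV (x, b) (conj Ax (BV' _ (subset_closure Bb))).
pose empty_slice := sasa_op_prod hU (@op_sa_set0 R S) (@rel_compact_set0 S).
exists (exist _ (U `*` set0) empty_slice); split.
  exists set0; split=> //; first exact: op_sa_set0.
  by split; [exact: rel_compact_set0|rewrite closure0].
by move=> z Pz; case: P0; exists z.
Qed.

(** A nonempty box A x B inside two slices lies in the slice U x B, which is contained in both, so
    compatibility along inclusions suffices. *)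
Lemma slice_family_compat (s : forall W, slices U V W -> F W) :
  (forall (W1 W2 : opens (site_sasa X S)) (i1 : slices U V W1)
     (i2 : slices U V W2) (h : W1 `<=` W2), res F h (s W2 i2) = s W1 i1) ->
  forall (W1 W2 P : opens (site_sasa X S)) (i1 : slices U V W1)
    (i2 : slices U V W2) (h1 : P `<=` W1) (h2 : P `<=` W2),
  sasa_box P -> res F h1 (s W1 i1) = res F h2 (s W2 i2).
Proof.
move=> cs W1 W2 P i1 i2 h1 h2 [A [B [hA [hB rB] PE]]].
have [[[a b] Pab]|] := pselect ((P : set (X * S)) !=set0); last exact: sections_empty.
have [Aa Bb] : A a /\ B b by rewrite PE in Pab.
have [V1 [hV1 [_ V1V] W1E]] := i1; have [V2 [hV2 [_ V2V] W2E]] := i2.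
have BV1 : B `<=` V1.
  move=> y By; have /h1 : (P : set (X * S)) (a, y) by rewrite PE.
  by rewrite W1E => -[].
have BV2 : B `<=` V2.
  move=> y By; have /h2 : (P : set (X * S)) (a, y) by rewrite PE.
  by rewrite W2E => -[].
pose W3 : opens (site_sasa X S) := exist _ (U `*` B) (sasa_op_prod hU hB rB).
have i3 : slices U V W3.
  exists B; split=> //; split=> //.
  by apply: subset_trans V1V; exact: closureS.
have h13 : W3 `<=` W1 by rewrite W1E => z [? ?]; split=> //; exact: BV1.
have h23 : W3 `<=` W2 by rewrite W2E => z [? ?]; split=> //; exact: BV2.
have h3 : P `<=` W3.
  rewrite PE => -[x y] [/= Ax By]; split=> //=.
  have /h1 : (P : set (X * S)) (x, b) by rewrite PE.
  by rewrite W1E => -[].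
by rewrite -(res_comp h3 h13) -(res_comp h3 h23) (cs _ _ i3) (cs _ _ i3).
Qed.

(** Cofinality in two steps: a section over a slice is a compatible family over its boxes, all of
    which are in the core, and each box of the core lies in a slice. *)
Theorem core_sections_proj_lim :
  exists p : forall W, slices U V W -> {linear core_presheaf F UV -> F W},
    is_proj_lim p /\
    forall (W P : opens (site_sasa X S)) (i : slices U V W) (c : core_opens UV P)
      (h : P `<=` W) (s : core_sections F UV), res F h (p W i s) = s P c.
Proof.
have cov := @boxes_cov R X S; have sub := @boxes_sub R X S.
have mono := @boxes_mono R X S; have cut := slice_boxes_core.
have lift W (i : slices U V W) := proj_lim_lift (sheaf_proj_lim cov sub mono sF W)
  (q := fun P b (s : core_sections F UV) => s P (cut W i P b))
  (fun P b k s t => erefl)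
  (fun P1 P2 b1 b2 h s => limit_compat s _ _ h).
pose p W i := projT1 (cid (lift W i)).
have pE (W P : opens (site_sasa X S)) (i : slices U V W) (c : core_opens UV P)
    (h : P `<=` W) (s : core_sections F UV) : res F h (p W i s) = s P c.
  have b : boxes_opens W P by split=> //; exact: core_box c.
  rewrite (Prop_irrelevance h (sub _ _ b)) (Prop_irrelevance c (cut W i P b)).
  by rewrite /p; case: cid => /= v ->.
exists p; split=> //; split=> [W1 W2 i1 i2 h s|s cs].
  apply: (base_sep cov sub sF) => P hP b.
  have c := cut _ i1 _ b.
  by rewrite (res_comp _ _ (subset_trans hP h)) !(pE _ _ _ c).
have indep := slice_family_compat cs.
(* The slice containing a box is chosen arbitrarily; [indep] shows that the restriction does not
   depend on it. *)
pose w P (c : core_opens UV P) := projT1 (cid (core_in_slice c)).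
have wi P (c : core_opens UV P) : slices U V (w P c).
  by rewrite /w; case: cid => ? [].
have wP P (c : core_opens UV P) : P `<=` w P c.
  by rewrite /w; case: cid => ? [].
have ct (P1 P2 : opens (site_sasa X S)) (c1 : core_opens UV P1)
    (c2 : core_opens UV P2) (h : P1 `<=` P2) :
    res F h (res F (wP P2 c2) (s _ (wi P2 c2))) = res F (wP P1 c1) (s _ (wi P1 c1)).
  by rewrite (res_comp _ _ (subset_trans h (wP P2 c2))); apply/indep/(core_box c1).
exists (Limit ct); split=> [W i|t ts].
  apply: (base_sep cov sub sF) => P hP b.
  rewrite (pE _ _ _ (cut _ i _ b)) /=.
  by apply: indep; case: b.
by apply: limit_ext => P c /=; rewrite -ts (pE _ _ _ c).
Qed.

End Slices.

(** The last clause identifies the projections: carried back by [eta], they are the restriction maps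
    of the inverse image, so the isomorphism with the limit is the canonical one. *)
Theorem proposition3p1 (R : realType) (X S : analytic_manifold R)
    (U : set X) (V : set S) (hU : op_sa U) (hV : open V)
    (F : presheaf R[i] (site_sasa X S)) (hF : is_sheaf F)
    (aF : presheaf R[i] (site_rel X S)) (eta : cross_hom F aF)
    (haF : is_inverse_image eta) :
  exists p : forall W' : opens (site_sasa X S), slices U V W' ->
      {linear aF (rel_prod hU hV) -> F W'},
    is_proj_lim p /\
    forall (W' : opens (site_sasa X S)) (i : slices U V W')
      (W : opens (site_rel X S)) (h : W `<=` W') (h' : W `<=` rel_prod hU hV) s,
      eta W W' h (p W' i s) = res aF h' s.
Proof.
have [psi [psiE psi_bij]] := inverse_image_core hF haF.
have [p [p_lim pE]] := core_sections_proj_lim hF hU hV.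
exists (fun W' i => p W' i \o psi (rel_prod hU hV)); split.
  exact: proj_lim_bij p_lim (psi_bij _) _.
move=> W' i W h h' s; have [g psiK _] := psi_bij W.
(* The two sections are compared after the injective [psi], where they become families over the
   boxes of the core of [W]. *)
apply: (can_inj psiK); rewrite psiE -hom_nat; apply: limit_ext => P c.
have c' := core_mono h' c.
by rewrite (core_resE h' (psi _ s) c c') /= (pE _ _ _ c').
Qed.
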